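(* Let $j\in[n]$ with $j\ge2$ and let $k\in\mathbb N$. An isomorphism $\mathbf{CK}_{x_j}^{\mu_j}:\mathcal P_k(\mathbb R^{j-1})\to\mathcal M_k^q(\mathbb R^j)$ is given by $$\mathbf{CK}_{x_j}^{\mu_j}=\sum_{\alpha=0}^k\frac{(-1)^{\frac{\alpha(\alpha+1)}2}q^{\frac{\alpha}{2}(\gamma_{[j]}+k-1)}}{[\mu_j,\alpha;q][\mu_j,\alpha-1;q]\cdots[\mu_j,1;q]}\,x_j^\alpha\left(D_{[j-1]}^q\right)^\alpha,$$ with $[\mu_j,m;q]=[\mu_j+m]_q-(-1)^m[\mu_j]_q$.
   Context: Let $q$ be a nonzero complex number with $|q|\neq1$ (fix a logarithm of $q$ to define $q^a$ for real $a$); $[a]_q=\frac{q^a-q^{-a}}{q-q^{-1}}$, $[n]=\{1,\dots,n\}$. $\mathcal P_k(\mathbb R^j)$ is the space of complex-valued homogeneous polynomials of degree $k$ in $x_1,\dots,x_j$. Fix $\mu_1,\dots,\mu_n>0$, $\gamma_i=\mu_i+\frac12$, $\gamma_{[j]}=\sum_{i\le j}\gamma_i$. Let $r_i$ be the substitution $x_i\mapsto-x_i$ and $T_{q,i}^{s}$ the substitution $x_i\mapsto q^sx_i$, and $$D_i^q=\frac{q^{\mu_i}}{q-q^{-1}}\,\frac{T_{q,i}-r_i}{x_i}-\frac{q^{-\mu_i}}{q-q^{-1}}\,\frac{T_{q,i}^{-1}-r_i}{x_i}.$$ For $1\le j\le n$, $$D_{[j]}^q=\sum_{i=1}^jD_i^qR_{[j],i}^q,\quad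 R^q_{[j],i}=\Big(\prod_{l<i}q^{-\gamma_l/2}T_{q,l}^{-1/2}\Big)\Big(\prod_{i<l\le j}q^{\gamma_l/2}T_{q,l}^{1/2}r_l\Big)\Big(\prod_{j<l\le n}r_l\Big),$$ and $\mathcal M_k^q(\mathbb R^j)=\ker(D_{[j]}^q)\cap\mathcal P_k(\mathbb R^j)$. (Empty products equal $1$.) *)

(* Defs.v *)
(* Polynomials are {mpoly R[i][n]} over the complex numbers R[i] = complex R of
   an arbitrary realType R; the analysis library only provides the real
   functions expR, cos and sin.

   Variables are indexed from 0: x_1, .., x_n are 'X_i with i : 'I_n, and a
   set [j] = {1, .., j} becomes {i : 'I_n | i < j}.  The spaces of polynomials
   in x_1, .., x_j, for all j <= n, are taken inside {mpoly R[i][n]}. *)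
From HB Require Import structures.
From mathcomp Require Import all_boot all_order all_algebra.
From mathcomp Require Import complex mpoly.
From mathcomp Require Import reals.
From mathcomp Require sequences trigo.

Set Implicit Arguments.
Unset Strict Implicit.
Unset Printing Implicit Defensive.

Import Order.TTheory GRing.Theory Num.Theory.
Local Open Scope ring_scope.
Local Open Scope complex_scope.

Definition expC (R : realType) (z : R[i]) : R[i] :=
  (sequences.expR (complex.Re z))%:C
  * (trigo.cos (complex.Im z) +i* trigo.sin (complex.Im z)).

(* q^a for real a, with respect to the logarithm logq of q. *)
Definition qpow (R : realType) (logq : R[i]) (a : R) : R[i] :=
  expC (a%:C * logq).

(* [a]_q *)
Definition qnum (R : realType) (q logq : R[i]) (a : R) : R[i] :=
  (qpow logq a - qpow logq (- a)) / (q - q^-1).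

(* [mu, m; q] *)
Definition qnum_mu (R : realType) (q logq : R[i]) (mu : R) (m : nat) : R[i] :=
  qnum q logq (mu + m%:R) - (-1) ^+ m * qnum q logq mu.

Section Substitutions.
Context {K : fieldType} {n : nat}.

(* The substitution x_i |-> c x_i. *)
Definition dilate (c : K) (i : 'I_n) (p : {mpoly K[n]}) : {mpoly K[n]} :=
  p \mPo [tuple (if l == i then c *: 'X_l else 'X_l) | l < n].

(* Quotient of p by x_i, the monomials without x_i being discarded; it is only
   applied to multiples of x_i, see mulX_divX_dilateB. *)
Definition divX (i : 'I_n) (p : {mpoly K[n]}) : {mpoly K[n]} :=
  \sum_(m <- msupp p | (0 < m i)%N) p@_m *: 'X_[m - U_(i)].

(* P_k(R^j): homogeneous polynomials of degree k in the first j variables. *)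
Definition homog_in (j k : nat) : {pred {mpoly K[n]}} :=
  [pred p : {mpoly K[n]} | (p \is k.-homog)
    && all (fun m : 'X_{1..n} => [forall l : 'I_n, (j <= l)%N ==> (m l == 0%N)])
           (msupp p)].

Definition linear_iso_between (A B : {pred {mpoly K[n]}})
    (f : {mpoly K[n]} -> {mpoly K[n]}) : Prop :=
  [/\ {in A &, forall p r, forall a : K, f (a *: p + r) = a *: f p + f r},
      {in A, forall p, f p \in B},
      {in A &, injective f}
    & {in B, forall r, exists2 p, p \in A & f p = r}].

Lemma mcoeff_dilate (c : K) i p m : (dilate c i p)@_m = c ^+ m i * p@_m.
Proof.
have dilX (m' : 'X_{1..n}) : dilate c i 'X_[m'] = c ^+ m' i *: 'X_[m'].
  rewrite /dilate comp_mpolyX (bigD1 i) //= tnth_mktuple eqxx exprZn.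
  rewrite -scalerAl [in RHS]mpolyXE_id [in RHS](bigD1 i) //=; congr (_ *: (_ * _)).
  by apply: eq_bigr => l /negPf li; rewrite tnth_mktuple li.
rewrite {1}/dilate comp_mpolyEX raddf_sum /=.
under eq_bigr => m' _.
  rewrite -/(dilate c i 'X_[m']) dilX !mcoeffZ mcoeffX.
  over.
have [mp|mp] := boolP (m \in msupp p).
  rewrite (bigD1_seq m) ?msupp_uniq //= eqxx mulr1 mulrC big1 ?addr0 // => m' mm.
  by rewrite (negPf mm) !mulr0.
rewrite (memN_msupp_eq0 mp) mulr0 big_seq big1 // => m' m'p.
by case: eqP => [mm|]; [rewrite -mm m'p in mp | rewrite !mulr0].
Qed.

Lemma mcoeff_divX i p m : (divX i p)@_m = p@_(m + U_(i)).
Proof.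
rewrite /divX raddf_sum /=.
have E (m' : 'X_{1..n}) : (0 < m' i)%N -> ((m' - U_(i))%MM == m) = (m' == (m + U_(i))%MM).
  move=> m'i; apply/eqP/eqP => [<-|->]; last by rewrite addmK.
  by rewrite submK // lep1mP -lt0n.
have [mp|mp] := boolP ((m + U_(i))%MM \in msupp p).
  rewrite (big_rem (m + U_(i))%MM) //= mnmDE mnm1E eqxx addn1 /=.
  rewrite mcoeffZ mcoeffX addmK eqxx mulr1 big_seq_cond big1 ?addr0 // => m'.
  rewrite mem_rem_uniq ?msupp_uniq // inE => /andP[/andP[mm _] m'i].
  by rewrite mcoeffZ mcoeffX E // (negPf mm) mulr0.
rewrite (memN_msupp_eq0 mp) big_seq_cond big1 // => m' /andP[m'p m'i].
rewrite mcoeffZ mcoeffX E //; case: eqP => [mm|_]; last by rewrite mulr0.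
by rewrite mm in m'p; rewrite m'p in mp.
Qed.

Lemma divX_mulX i (p : {mpoly K[n]}) : divX i ('X_i * p) = p.
Proof. by apply/mpolyP => m; rewrite mcoeff_divX addmC mulrC mcoeffMX. Qed.

Lemma mulX_divX i (p : {mpoly K[n]}) :
  {in msupp p, forall m : 'X_{1..n}, 0 < m i}%N -> 'X_i * divX i p = p.
Proof.
move=> pi; apply/mpolyP => m; have [mi|mi] := posnP (m i).
  rewrite mcoeffMr big1 => [|[m1 m2] /eqP /= e].
    apply/esym/memN_msupp_eq0/negP => /pi; by rewrite mi.
  rewrite mcoeffX; case: eqP => [e1|_]; last by rewrite mul0r.
  by have := congr1 (fun m' : 'X_{1..n} => m' i) e; rewrite /= mi -e1 mnmDE mnm1E eqxx addn1.
have {1}-> : m = (U_(i) + (m - U_(i)))%MM by rewrite addmC submK // lep1mP -lt0n.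
by rewrite mulrC mcoeffMX mcoeff_divX submK // lep1mP -lt0n.
Qed.

Lemma mulX_divX_dilateB i c d (p : {mpoly K[n]}) :
  'X_i * divX i (dilate c i p - dilate d i p) = dilate c i p - dilate d i p.
Proof.
apply: mulX_divX => m; rewrite mcoeff_msupp mcoeffB !mcoeff_dilate lt0n.
by apply: contraNneq => ->; rewrite !expr0 subrr.
Qed.

Lemma dilate_linear c i : linear (dilate c i).
Proof. by move=> a p r; rewrite /dilate linearP. Qed.

Lemma divX_linear i : linear (divX i).
Proof. by move=> a p r; apply/mpolyP => m; rewrite !(mcoeff_divX, mcoeffD, mcoeffZ). Qed.

Lemma comp_linear (f g : {mpoly K[n]} -> {mpoly K[n]}) :
  linear f -> linear g -> linear (f \o g).
Proof. by move=> fL gL a p r; rewrite /= gL fL. Qed.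

Lemma scale_linear (u : K) (f : {mpoly K[n]} -> {mpoly K[n]}) :
  linear f -> linear (fun p => u *: f p).
Proof. by move=> fL a p r; rewrite fL scalerDr !scalerA (mulrC u). Qed.

Lemma sub_linear (f g : {mpoly K[n]} -> {mpoly K[n]}) :
  linear f -> linear g -> linear (fun p => f p - g p).
Proof. by move=> fL gL a p r; rewrite fL gL scalerBr opprD addrACA. Qed.

Lemma bigcomp_linear (P : pred 'I_n) (F : 'I_n -> {mpoly K[n]} -> {mpoly K[n]}) :
  (forall l, linear (F l)) -> linear (\big[comp/id]_(l < n | P l) F l).
Proof.
by move=> FL; elim/big_rec: _ => // l f _; apply: comp_linear.
Qed.

Lemma homog_in_submod j k : submod_closed (homog_in j k).
Proof.
split=> [|a p r /andP[pk /allP pj] /andP[rk /allP rj]]; rewrite inE.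
  by rewrite rpred0 msupp0.
rewrite rpredD ?rpredZ //=; apply/allP => m /msuppD_le; rewrite mem_cat.
by case/orP => [/msuppZ_le|]; [apply: pj | apply: rj].
Qed.

End Substitutions.

Section Operators.
Context {R : realType} {n : nat}.
Implicit Types (q logq : R[i]) (mu : 'I_n -> R) (i j : 'I_n) (k : nat).

Definition qshift logq (s : R) i : {mpoly R[i][n]} -> {mpoly R[i][n]} :=
  dilate (qpow logq s) i.

Definition refl i : {mpoly R[i][n]} -> {mpoly R[i][n]} := dilate (-1) i.

Definition gam mu i : R := mu i + 2^-1.

(* gamma_{[j]} *)
Definition gam_sum mu (j : nat) : R := \sum_(i < n | (i < j)%N) gam mu i.

(* D_i^q *)
Definition qdunkl q logq mu i (p : {mpoly R[i][n]}) : {mpoly R[i][n]} :=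
  (qpow logq (mu i) / (q - q^-1))
    *: divX i (qshift logq 1 i p - refl i p)
  - (qpow logq (- mu i) / (q - q^-1))
    *: divX i (qshift logq (-1) i p - refl i p).

(* R_{[j],i}^q; the products are compositions of (commuting) operators. *)
Definition qtwist logq mu (j : nat) i : {mpoly R[i][n]} -> {mpoly R[i][n]} :=
  (\big[comp/id]_(l < n | (l < i)%N)
     fun p => qpow logq (- (gam mu l / 2)) *: qshift logq (- 2^-1) l p)
  \o (\big[comp/id]_(l < n | (i < l < j)%N)
     fun p => qpow logq (gam mu l / 2) *: qshift logq 2^-1 l (refl l p))
  \o (\big[comp/id]_(l < n | (j <= l)%N) refl l).

(* D_{[j]}^q *)
Definition qdirac q logq mu (j : nat) (p : {mpoly R[i][n]}) : {mpoly R[i][n]} :=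
  \sum_(i < n | (i < j)%N) qdunkl q logq mu i (qtwist logq mu j i p).

(* M_k^q(R^j) *)
Definition qmonogenic q logq mu (j k : nat) : {pred {mpoly R[i][n]}} :=
  [pred p | (qdirac q logq mu j p == 0) && (p \in homog_in j k)].

(* CK_{x_J}^{mu_J} for the variable x_J = 'X_j, where J = j.+1: D_{[J-1]} is
   qdirac of the first j variables, gamma_{[J]} sums over the first j.+1. *)
Definition CK q logq mu j k (p : {mpoly R[i][n]}) : {mpoly R[i][n]} :=
  \sum_(a < k.+1)
    ((-1) ^+ ((a * a.+1)./2)
     * qpow logq (a%:R / 2 * (gam_sum mu j.+1 + k%:R - 1))
     / \prod_(1 <= m < a.+1) qnum_mu q logq (mu j) m)
    *: ('X_j ^+ a * iter a (qdirac q logq mu j) p).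

Lemma qdunkl_linear q logq mu i : linear (qdunkl q logq mu i).
Proof.
by apply: sub_linear; apply: scale_linear; apply: comp_linear (@divX_linear _ _ i) _;
  apply: sub_linear; apply: dilate_linear.
Qed.

Lemma qtwist_linear logq mu j i : linear (qtwist logq mu j i).
Proof.
apply: comp_linear; first apply: comp_linear.
- by apply: bigcomp_linear => l; apply: scale_linear; apply: dilate_linear.
- apply: bigcomp_linear => l; apply: scale_linear.
  by apply: (@comp_linear _ n); apply: dilate_linear.
- by apply: bigcomp_linear => l; apply: dilate_linear.
Qed.

Lemma qdirac_linear q logq mu j : linear (qdirac q logq mu j).
Proof.
move=> a p r; rewrite /qdirac scaler_sumr -big_split; apply: eq_bigr => i _ /=.
by rewrite qtwist_linear qdunkl_linear.
Qed.

Lemma qmonogenic_submod q logq mu j k :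
  submod_closed (qmonogenic q logq mu j k).
Proof.
have [P0 PL] := @homog_in_submod (R[i] : fieldType) n j k.
split=> [|a p r /andP[/eqP p0 pP] /andP[/eqP r0 rP]]; rewrite inE.
  have := qdirac_linear q logq mu j (-1) 0 0.
  by rewrite scaler0 add0r scaleN1r addNr => ->; rewrite eqxx.
by rewrite qdirac_linear p0 r0 scaler0 addr0 eqxx PL.
Qed.

End Operators.

(* Main.v *)
Require Import Defs.
From HB Require Import structures.
From mathcomp Require Import all_boot all_order all_algebra.
From mathcomp Require Import complex mpoly.
From mathcomp Require Import reals.
From mathcomp Require sequences exp trigo.
From mathcomp Require Import ring.

Set Implicit Arguments.
Unset Strict Implicit.
Unset Printing Implicit Defensive.

Import Order.TTheory GRing.Theory Num.Theory.
Local Open Scope ring_scope.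
Local Open Scope complex_scope.

(* Write r in P_k(R^j) as a sum of x_j^a r_a with r_a in P_{k-a}(R^{j-1}).  The
   coefficient of x_j^a in D_{[j]} r is a multiple of D_{[j-1]} r_a plus a
   multiple of r_{a+1}; the latter factor is nonzero because [mu, m; q] vanishes
   only if |q^m| = 1 or |q^{2 mu + m}| = 1.  Hence D_{[j]} r = 0 is a recurrence
   determining every r_a from r_0, which may be arbitrary, and solving it gives
   the coefficients of CK. *)

(** * Real powers of [q], and nonvanishing of [[mu, m; q]] *)

Section ComplexExponential.
Variable R : realType.

Lemma expCD (x y : R[i]) : expC (x + y) = expC x * expC y.
Proof.
case: x y => [a b] [c d]; rewrite /expC /= exp.expRD trigo.cosD trigo.sinD.
by simpc; congr (_ +i* _); ring.
Qed.

Lemma normr_expC (x : R[i]) : `|expC x| = (sequences.expR (complex.Re x))%:C.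
Proof.
rewrite normc_def; case: x => [a b]; rewrite /expC /=; congr (_%:C).
have -> t : (t * trigo.cos b - 0 * trigo.sin b) ^+ 2
  + (t * trigo.sin b + 0 * trigo.cos b) ^+ 2
  = t ^+ 2 * (trigo.cos b ^+ 2 + trigo.sin b ^+ 2) :> R by ring.
by rewrite trigo.cos2Dsin2 mulr1 sqrtr_sqr ger0_norm ?exp.expR_ge0.
Qed.

Variable logq : R[i].

Lemma qpowD a b : qpow logq (a + b) = qpow logq a * qpow logq b.
Proof. by rewrite /qpow rmorphD mulrDl expCD. Qed.

Lemma qpow0 : qpow logq 0 = 1.
Proof.
rewrite /qpow mul0r /expC /= exp.expR0 trigo.cos0 trigo.sin0 mul1r.
exact: complexr0.
Qed.

Lemma qpow_neq0 a : qpow logq a != 0.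
Proof.
apply/negP => /eqP qa0; have := oner_neq0 R[i].
by rewrite -qpow0 -(subrr a) qpowD qa0 mul0r eqxx.
Qed.

Lemma qpowN a : qpow logq (- a) = (qpow logq a)^-1.
Proof.
by apply: (mulfI (qpow_neq0 a)); rewrite -qpowD subrr qpow0 divff ?qpow_neq0.
Qed.

Lemma qpowMn a m : qpow logq (a * m%:R) = qpow logq a ^+ m.
Proof.
elim: m => [|m IHm]; first by rewrite mulr0 qpow0.
by rewrite -natr1 mulrDr mulr1 qpowD IHm exprSr.
Qed.

Lemma qpow_sum (I : finType) (P : pred I) (F : I -> R) :
  qpow logq (\sum_(i | P i) F i) = \prod_(i | P i) qpow logq (F i).
Proof. exact: (big_morph _ qpowD qpow0). Qed.

Lemma normr_qpow a :
  `|qpow logq a| = (sequences.expR (a * complex.Re logq))%:C.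
Proof.
by rewrite /qpow normr_expC; case: logq => x y /=; rewrite mul0r subr0.
Qed.

Variable q : R[i].
Hypotheses (normq_neq1 : `|q| != 1) (logqP : expC logq = q).

Lemma qpow1 : qpow logq 1 = q.
Proof. by rewrite /qpow mul1r. Qed.

(** The modulus of [q^a] is [exp (a * Re logq)]; for nonzero [a] it equals 1 only if [Re logq = 0],
    and then [|q| = 1]. *)
Lemma normr_qpow_neq1 a : a != 0 -> `|qpow logq a| != 1.
Proof.
move=> a0; apply: contraNneq normq_neq1; rewrite normr_qpow -logqP normr_expC.
move=> [] /eqP; rewrite -[X in _ == X]exp.expR0 => /eqP /exp.expR_inj /eqP.
by rewrite mulf_eq0 (negPf a0) => /= /eqP ->; rewrite exp.expR0.
Qed.

Lemma qpow_neq_sign a m : a != 0 -> qpow logq a != (-1) ^+ m.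
Proof.
by move=> /normr_qpow_neq1; apply: contraNneq => ->; rewrite normrX normrN1 expr1n.
Qed.

Lemma qsub_neq0 : q - q^-1 != 0.
Proof.
rewrite -qpow1 -qpowN subr_eq0; apply/negP => /eqP q1.
(* If [q = q^-1], then [q^2 = 1 = (-1)^0], against the previous lemma with exponent 2. *)
have /(qpow_neq_sign 0)/negP[] : (1 + 1 : R) != 0 by rewrite (pnatr_eq0 R 2).
by rewrite qpowD {2}q1 -qpowD subrr qpow0 expr0.
Qed.

Lemma qnum_mu_neq0 mu m : 0 < mu -> (0 < m)%N -> qnum_mu q logq mu m != 0.
Proof.
move=> mu0 m0; have qB := qsub_neq0.
(* With [e = (-1)^m] and [e^2 = 1], the numerator [q^(mu+m) - q^-(mu+m) - e (q^mu - q^-mu)] factors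
   as [(q^m - e) (q^mu + e q^-(mu+m))]. *)
have -> : qnum_mu q logq mu m =
    (qpow logq m%:R - (-1) ^+ m)
    * (qpow logq mu + (-1) ^+ m / qpow logq (mu + m%:R)) / (q - q^-1).
  rewrite /qnum_mu /qnum mulrA -mulrBl !qpowN !qpowD; congr (_ / _).
  have u0 := qpow_neq0 mu; have v0 := qpow_neq0 m%:R.
  rewrite -[in LHS]signr_odd -[in RHS]signr_odd.
  by case: (odd m); field; rewrite u0 v0.
rewrite !mulf_neq0 ?invr_eq0 //.
  by rewrite subr_eq0 qpow_neq_sign // pnatr_eq0 -lt0n.
have s0 : 0 < mu + (mu + m%:R) by rewrite !addr_gt0 ?ltr0n.
(* If the second factor vanished, [q^(2 mu + m)] would equal [(-1)^(m+1)]. *)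
have := qpow_neq_sign m.+1 (lt0r_neq0 s0); apply: contraNneq => /eqP.
rewrite addr_eq0 => /eqP e; rewrite qpowD e exprS mulN1r mulNr divfK //.
exact: qpow_neq0.
Qed.

End ComplexExponential.

(** * Homogeneity read on coefficients, and expansion in powers of [x_j] *)

Section Coefficients.
Variables (K : fieldType) (n : nat).
Implicit Types (p r : {mpoly K[n]}) (m : 'X_{1..n}) (j : 'I_n).

Lemma homog_inP (j k : nat) p :
  reflect (forall m, p@_m != 0 -> mdeg m = k /\
             forall l : 'I_n, (j <= l)%N -> m l = 0%N)
          (p \in homog_in j k).
Proof.
apply: (iffP andP) => [[/dhomogP pk /allP pj] m|H].
  rewrite -mcoeff_msupp => mp; split; first exact: pk.
  by move=> l jl; have /forallP/(_ l) := pj _ mp; rewrite jl => /eqP.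
split; first by apply/dhomogP => m; rewrite mcoeff_msupp => /H[].
apply/allP => m; rewrite mcoeff_msupp => /H[_ mj].
by apply/forallP => l; apply/implyP => /mj ->.
Qed.

Lemma mcoeff_bigcomp (P : pred 'I_n) F (c : 'I_n -> 'X_{1..n} -> K) p m :
  (forall l p m, (F l p)@_m = c l m * p@_m) ->
  ((\big[comp/id]_(l < n | P l) F l) p)@_m = (\prod_(l < n | P l) c l m) * p@_m.
Proof.
move=> Fc; elim/big_rec2: _ => [|l f x _ IH]; first by rewrite mul1r.
by rewrite /= Fc IH mulrA.
Qed.

(* The coefficient of x_j^a, as a polynomial in the other variables. *)
Definition slice j a p : {mpoly K[n]} := dilate 0 j (iter a (divX j) p).

Lemma mcoeff_slice j a p m :
  (slice j a p)@_m = if m j == 0%N then p@_(m + U_(j) *+ a) else 0.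
Proof.
(* Dilation by 0 substitutes [x_j = 0]: since [0^0 = 1], it keeps exactly the monomials free of
   [x_j]. *)
rewrite mcoeff_dilate expr0n; case: eqP => _; rewrite ?mul0r ?mul1r //.
elim: a m => [|a IHa] m; first by rewrite mulm0n addm0.
by rewrite /= mcoeff_divX IHa mulmS addmA.
Qed.

Lemma mcoeff_slice_split j p m :
  p@_m = (slice j (m j) p)@_(m - U_(j) *+ m j).
Proof.
rewrite mcoeff_slice mnmBE mulmnE mnm1E eqxx mul1n subnn eqxx submK //.
apply/mnm_lepP => l; rewrite mulmnE mnm1E.
by case: eqP => [<-|_]; rewrite ?mul1n ?mul0n.
Qed.

Lemma slice_inj j p r : (forall a, slice j a p = slice j a r) -> p = r.
Proof.
by move=> E; apply/mpolyP => m; rewrite (mcoeff_slice_split j) E -mcoeff_slice_split.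
Qed.

Lemma slice_linear j a : linear (slice j a).
Proof.
move=> c p r; apply/mpolyP => m; rewrite mcoeffD mcoeffZ !mcoeff_slice.
by case: eqP => _; rewrite ?mulr0 ?addr0 // mcoeffD mcoeffZ.
Qed.

HB.instance Definition _ j a :=
  GRing.isLinear.Build K {mpoly K[n]} {mpoly K[n]} _ (slice j a) (slice_linear j a).

Lemma slice0_mulX j p : slice j 0 ('X_j * p) = 0.
Proof.
rewrite /slice /= /dilate rmorphM /= comp_mpolyXU.
by rewrite -tnth_nth tnth_mktuple eqxx scale0r mul0r.
Qed.

Lemma sliceS_mulX j a p : slice j a.+1 ('X_j * p) = slice j a p.
Proof. by rewrite /slice iterSr divX_mulX. Qed.

(** With indices from 0, [homog_in j k] involves only the variables before [x_j], so [p] acts as a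
    constant in [x_j]. *)
Lemma slice_mulXn j a b k p : p \in homog_in j k ->
  slice j b ('X_j ^+ a * p) = if a == b then p else 0.
Proof.
move=> /homog_inP pj; elim: a b => [|a IHa] [|b].
- apply/mpolyP => m; rewrite expr0 mul1r mcoeff_slice mulm0n addm0.
  case: eqP => // mj; apply/esym/eqP; apply: contra_notT mj => /pj[_]; exact.
- apply/mpolyP => m; rewrite expr0 mul1r mcoeff_slice mcoeff0; case: eqP => // _.
  apply/eqP; apply: contraT => /pj[_ /(_ j (leqnn _))].
  by rewrite mnmDE mulmnE mnm1E eqxx mul1n addnS.
- by rewrite exprS -mulrA slice0_mulX.
- by rewrite exprS -mulrA sliceS_mulX IHa.
Qed.

(** For [a > k] the truncated degree [k - a] is harmless, since the slice is then zero. *)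
Lemma homog_in_slice j a k p :
  p \in homog_in j.+1 k -> slice j a p \in homog_in j (k - a).
Proof.
move=> /homog_inP pj; apply/homog_inP => m; rewrite mcoeff_slice.
case: (m j =P 0%N) => [mj|_]; last by rewrite eqxx.
move=> /pj[mk ml].
split; first by rewrite -mk mdegD mdegMn mdeg1 mul1n addnK.
move=> l; rewrite leq_eqVlt => /predU1P[/val_inj<- //|jl].
move: (ml _ jl) => /eqP.
by rewrite mnmDE addn_eq0 => /andP[/eqP].
Qed.

Lemma slice_gt_eq0 j a k p : p \in homog_in j.+1 k -> (k < a)%N -> slice j a p = 0.
Proof.
move=> /homog_inP pj ka; apply/mpolyP => m; rewrite mcoeff_slice mcoeff0.
case: eqP => // _; apply/eqP; apply: contraT => /pj[mk _].
by move: ka; rewrite -mk mdegD mdegMn mdeg1 mul1n ltnNge leq_addl.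
Qed.

Lemma homog_in_slices j k p :
    (forall a, (a <= k)%N -> slice j a p \in homog_in j (k - a)) ->
    (forall a, (k < a)%N -> slice j a p = 0) ->
  p \in homog_in j.+1 k.
Proof.
move=> pj p0; apply/homog_inP => m; rewrite (mcoeff_slice_split j).
have [mk|/p0->] := leqP (m j) k; last by rewrite mcoeff0 eqxx.
have Um : (U_(j) *+ m j <= m)%MM.
  apply/mnm_lepP => l; rewrite mulmnE mnm1E.
  by case: eqP => [<-|_]; rewrite ?mul1n ?mul0n.
move/(homog_inP _ _ _ (pj _ mk)) => [md ml]; split.
  by rewrite -(submK Um) mdegD mdegMn mdeg1 mul1n md subnK.
move=> l jl; have := ml l (ltnW jl); rewrite mnmBE mulmnE mnm1E.
by rewrite -val_eqE /= ltn_eqF // mul0n subn0.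
Qed.

End Coefficients.

(** * Action of the Dunkl and twist operators on monomials *)

Section DunklTwist.
Variables (K : fieldType) (n : nat).
Variables (A B u v : 'I_n -> K) (c d s t : K).
Implicit Types (p r : {mpoly K[n]}) (m : 'X_{1..n}) (i j : 'I_n) (k a : nat).

(** [qdunkl] with free constants: [A] and [B] stand for [q^mu_i / (q - q^-1)] and
    [q^-mu_i / (q - q^-1)], [c] and [d] for [q] and [q^-1]. *)
Definition dunkl i p : {mpoly K[n]} :=
  A i *: divX i (dilate c i p - dilate (-1) i p)
  - B i *: divX i (dilate d i p - dilate (-1) i p).

(** [qtwist] with free constants: [u], [v] stand for [q^(-gamma_l/2)], [q^(gamma_l/2)] and [s], [t]
    for [q^(-1/2)], [q^(1/2)]. *)
Definition twist k i : {mpoly K[n]} -> {mpoly K[n]} :=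
  (\big[comp/id]_(l < n | (l < i)%N) fun p => u l *: dilate s l p)
  \o (\big[comp/id]_(l < n | (i < l < k)%N)
        fun p => v l *: dilate t l (dilate (-1) l p))
  \o (\big[comp/id]_(l < n | (k <= l)%N) dilate (-1) l).

(* dunkl i maps x_i^a to dunkl_coef i a * x_i^(a-1). *)
Definition dunkl_coef i a : K :=
  A i * (c ^+ a - (-1) ^+ a) - B i * (d ^+ a - (-1) ^+ a).

(** The eigenvalue of [twist k i] on the monomial with exponent [m]. *)
Definition twist_coef k i m : K :=
  (\prod_(l < n | (l < i)%N) (u l * s ^+ m l))
  * (\prod_(l < n | (i < l < k)%N) (v l * (t ^+ m l * (-1) ^+ m l)))
  * \prod_(l < n | (k <= l)%N) (-1) ^+ m l.

Lemma mcoeff_dunkl i p m :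
  (dunkl i p)@_m = dunkl_coef i (m i).+1 * p@_(m + U_(i)).
Proof.
have coef b : (divX i (dilate b i p - dilate (-1) i p))@_m
    = (b ^+ (m i).+1 - (-1) ^+ (m i).+1) * p@_(m + U_(i)).
  rewrite mcoeff_divX mcoeffB [X in X - _ = _]mcoeff_dilate.
  by rewrite [X in _ - X = _]mcoeff_dilate mulrBl mnmDE mnm1E eqxx addn1.
rewrite mcoeffB [X in X - _ = _]mcoeffZ [X in _ - X = _]mcoeffZ.
rewrite [X in _ * X - _ = _]coef [X in _ - _ * X = _]coef.
by rewrite /dunkl_coef; ring.
Qed.

Lemma mcoeff_twist k i p m : (twist k i p)@_m = twist_coef k i m * p@_m.
Proof.
rewrite /twist /= (mcoeff_bigcomp _ _ _ (c := fun l m => u l * s ^+ m l)); last first.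
  by move=> l p' m'; rewrite mcoeffZ mcoeff_dilate mulrA.
rewrite (mcoeff_bigcomp _ _ _ (c := fun l m => v l * (t ^+ m l * (-1) ^+ m l))); last first.
  by move=> l p' m'; rewrite mcoeffZ !mcoeff_dilate !mulrA.
rewrite (mcoeff_bigcomp _ _ _ (c := fun l m => (-1) ^+ m l)) ?mulrA //.
by move=> l p' m'; rewrite mcoeff_dilate.
Qed.

End DunklTwist.

(** * The Dirac operator, known only through its coefficients *)

Section Dirac.
Variables (K : fieldType) (n : nat).
Variables (u v : 'I_n -> K) (s t : K) (w : 'I_n -> nat -> K).
Variable dirac : nat -> {mpoly K[n]} -> {mpoly K[n]}.
Implicit Types (p r : {mpoly K[n]}) (m : 'X_{1..n}) (i j : 'I_n) (k a : nat).

Local Notation twist_coef := (twist_coef u v s t).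

Hypothesis mcoeff_dirac : forall k p m,
  (dirac k p)@_m = \sum_(i < n | (i < k)%N)
    w i (m i).+1 * twist_coef k i (m + U_(i)) * p@_(m + U_(i)).

Lemma dirac_linear k : linear (dirac k).
Proof.
move=> b p r; apply/mpolyP => m; rewrite mcoeffD mcoeffZ !mcoeff_dirac.
rewrite mulr_sumr -big_split /=; apply: eq_bigr => i _.
by rewrite mcoeffD mcoeffZ; ring.
Qed.

Lemma diracZ k b p : dirac k (b *: p) = b *: dirac k p.
Proof.
apply/mpolyP => m; rewrite mcoeffZ !mcoeff_dirac mulr_sumr.
by apply: eq_bigr => i _; rewrite mcoeffZ; ring.
Qed.

(** Passing from [j] to [j.+1] moves [x_j] from the trailing product of reflections to the middle
    one. The reflection sign occurs in both, so only [v j * t ^+ m j] is gained. *)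
Lemma twist_coefS i j m : (i < j)%N ->
  twist_coef j.+1 i m = v j * t ^+ m j * twist_coef j i m.
Proof.
move=> ij; rewrite /twist_coef.
rewrite [\prod_(l < n | (i < l < j.+1)%N) _](bigD1 j) /=; last by rewrite ij ltnSn.
rewrite [\prod_(l < n | (j <= l)%N) _](bigD1 j) //=.
have E1 (l : 'I_n) : (i < l < j.+1)%N && (l != j) = (i < l < j)%N.
  by rewrite ltnS -andbA -val_eqE (ltn_neqAle l) [(_ != _) && _]andbC.
have E2 (l : 'I_n) : (j <= l)%N && (l != j) = (j < l)%N.
  by rewrite ltn_neqAle -val_eqE andbC eq_sym.
rewrite (eq_bigl _ _ E1) (eq_bigl _ _ E2).
ring.
Qed.

Lemma mnmD_muln_neq j m a (l : 'I_n) : l != j -> (m + U_(j) *+ a)%MM l = m l.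
Proof. by move=> /negPf lj; rewrite mnmDE mulmnE mnm1E eq_sym lj mul0n addn0. Qed.

(** Here [x_j] meets only the trailing reflections, which give [x_j^a] the sign [(-1)^a]. *)
Lemma twist_coefD i j m a : (i < j)%N ->
  twist_coef j i (m + U_(j) *+ a) = (-1) ^+ a * twist_coef j i m.
Proof.
move=> ij; rewrite /twist_coef.
rewrite ![\prod_(l < n | (j <= l)%N) _](bigD1 j) //=.
rewrite mnmDE mulmnE mnm1E eqxx mul1n exprD.
rewrite [X in X * _ * _ = _](eq_bigr (fun l => u l * s ^+ m l)); last first.
  by move=> l li; rewrite mnmD_muln_neq // -val_eqE /= ltn_eqF // (ltn_trans li).
rewrite [X in _ * X * _ = _](eq_bigr (fun l => v l * (t ^+ m l * (-1) ^+ m l)));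
  last first.
  by move=> l /andP[_ lj]; rewrite mnmD_muln_neq // -val_eqE /= ltn_eqF.
rewrite [X in _ * (_ * X) = _](eq_bigr (fun l => (-1) ^+ m l)); last first.
  by move=> l /andP[_ lj]; rewrite mnmD_muln_neq.
ring.
Qed.

(** The middle product is empty and the trailing variables do not occur in [m]. In the first product
    the exponents of the variables before [x_j] add up to the whole degree of [m]. *)
Lemma twist_coef_last j m a : (forall l : 'I_n, (j <= l)%N -> m l = 0%N) ->
  twist_coef j.+1 j (m + U_(j) *+ a)
  = (\prod_(l < n | (l < j)%N) u l) * s ^+ mdeg m.
Proof.
move=> m0; rewrite /twist_coef [X in _ * X * _]big1 ?mulr1; last first.
  by move=> l; rewrite ltnS ltnNge; case: leq.
rewrite [X in _ * X]big1 ?mulr1; last first.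
  by move=> l jl; rewrite mnmD_muln_neq ?m0 ?(ltnW jl) // -val_eqE /= gtn_eqF.
rewrite big_split /=; congr (_ * _).
rewrite (eq_bigr (fun l => s ^+ m l)); last first.
  by move=> l lj; rewrite mnmD_muln_neq // -val_eqE /= ltn_eqF.
rewrite -expr_sum mdegE; congr (_ ^+ _).
rewrite [RHS](bigID (fun l : 'I_n => l < j)%N) /= [X in (_ + X)%N]big1 ?addn0 //.
by move=> l; rewrite -leqNgt => /m0.
Qed.

Lemma dirac_support j p m : (dirac j p)@_m != 0 ->
  exists2 i : 'I_n, (i < j)%N & p@_(m + U_(i)) != 0.
Proof.
have [/existsP[i /andP[ij pi]] _|/existsPn none] :=
    boolP [exists i : 'I_n, (i < j)%N && (p@_(m + U_(i)) != 0)].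
  by exists i.
rewrite mcoeff_dirac big1 ?eqxx // => i ij; have := none i.
by rewrite ij negbK => /eqP ->; rewrite mulr0.
Qed.

Lemma homog_in_dirac j k p : p \in homog_in j k -> dirac j p \in homog_in j k.-1.
Proof.
move=> /homog_inP pj; apply/homog_inP => m /dirac_support[i ij /pj[<- ml]].
rewrite mdegD mdeg1 addn1; split=> // l /ml /eqP.
by rewrite mnmDE addn_eq0 => /andP[/eqP].
Qed.

(** Needed apart from [homog_in_dirac], whose degree is truncated at [0.-1 = 0]; it makes the
    iterates vanish beyond degree [k]. *)
Lemma dirac_homog0 j p : p \in homog_in j 0 -> dirac j p = 0.
Proof.
move=> /homog_inP pj; apply/mpolyP => m; rewrite mcoeff0; apply/eqP.
by apply: contraT => /dirac_support[i _ /pj[]]; rewrite mdegD mdeg1 addn1.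
Qed.

Lemma homog_in_iter_dirac j k a p :
  p \in homog_in j k -> iter a (dirac j) p \in homog_in j (k - a).
Proof.
move=> pj; elim: a => [|a IHa]; first by rewrite subn0.
by rewrite subnS; apply: homog_in_dirac.
Qed.

Lemma iter_dirac_gt j k a p :
  p \in homog_in j k -> (k < a)%N -> iter a (dirac j) p = 0.
Proof.
move=> pj; elim: a => // a IHa; rewrite ltnS leq_eqVlt => /predU1P[ka|/IHa /= ->].
  apply: (@dirac_homog0 j).
  by have := homog_in_iter_dirac a pj; rewrite ka subnn.
by apply: (@dirac_homog0 j 0); apply/homog_inP => m; rewrite mcoeff0 eqxx.
Qed.

(** The summands [i < j] leave the power of [x_j] alone and assemble to [dirac j], up to the factor
    by which [x_j^a] is twisted. The summand [i = j] lowers [x_j^(a+1)] to [x_j^a]; its twist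
    depends only on the degree [k - (a+1)] of the slice. *)
Lemma slice_dirac j k a r : r \in homog_in j.+1 k ->
  slice j a (dirac j.+1 r) =
    ((-1) ^+ a * v j * t ^+ a) *: dirac j (slice j a r)
    + (w j a.+1 * (\prod_(l < n | (l < j)%N) u l) * s ^+ (k - a.+1))
        *: slice j a.+1 r.
Proof.
move=> rj; apply/mpolyP => m; rewrite mcoeffD !mcoeffZ !mcoeff_slice !mcoeff_dirac.
have [mj|mj] := eqVneq (m j) 0%N; last first.
  rewrite big1 ?mulr0 ?addr0 // => i ij; rewrite mcoeff_slice mnmDE addn_eq0.
  by rewrite (negPf mj) mulr0.
rewrite (bigD1 j) //= addrC mnmDE mulmnE mnm1E eqxx mul1n mj add0n -addmA -mulmSr.
congr (_ + _).
  rewrite mulr_sumr (eq_bigl (fun i : 'I_n => i < j)%N); last first.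
    by move=> i; rewrite ltnS -val_eqE andbC -ltn_neqAle.
  apply: eq_bigr => i ij.
  have ijN : i != j by rewrite -val_eqE /= ltn_eqF.
  rewrite mcoeff_slice mnmD_muln_neq // -addmA [(U_(j) *+ a + _)%MM]addmC addmA.
  rewrite twist_coefS // twist_coefD // !mnmDE mulmnE !mnm1E eqxx (negPf ijN) mj.
  by rewrite mul1n eqxx; ring.
(* Homogeneity fixes the degree of [m] only where the coefficient of [r] is nonzero. *)
have [-> |r0] := eqVneq (r@_(m + U_(j) *+ a.+1)) 0; first by rewrite !mulr0.
have /homog_inP/(_ m) := homog_in_slice a.+1 rj.
rewrite mcoeff_slice mj eqxx => /(_ r0)[mk m0].
by rewrite twist_coef_last // mk mulrA.
Qed.

(** * The recurrence for the slices and its solution *)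

Variables (j : 'I_n) (k : nat) (e : nat -> K).
Hypotheses (u0 : forall l, u l != 0) (s0 : s != 0)
  (w0 : forall a, w j a.+1 != 0).
Hypotheses (e0 : e 0 = 1).
(** Exactly what makes the slices [e a *: iter a (dirac j) p] satisfy the recurrence of
    [dirac_eq0P]. *)
Hypothesis eS : forall a, (a < k)%N ->
  w j a.+1 * (\prod_(l < n | (l < j)%N) u l) * s ^+ (k - a.+1) * e a.+1
  = - ((-1) ^+ a * v j * t ^+ a * e a).

Definition CK_ext p : {mpoly K[n]} :=
  \sum_(a < k.+1) e a *: ('X_j ^+ a * iter a (dirac j) p).

Lemma slice_CK_ext a p : p \in homog_in j k ->
  slice j a (CK_ext p) = e a *: iter a (dirac j) p.
Proof.
move=> pj; rewrite /CK_ext linear_sum /=.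
under eq_bigr => b _.
  rewrite linearZ /= (slice_mulXn _ _ (homog_in_iter_dirac b pj)).
  over.
have [ak|ka] := ltnP a k.+1; last first.
  (* Beyond [k] both sides vanish: the sum has no such power of [x_j], and the iterate is zero. *)
  rewrite (iter_dirac_gt pj) // scaler0 big1 // => b _.
  by rewrite ltn_eqF ?scaler0 // (leq_trans (ltn_ord b)).
rewrite (bigD1 (Ordinal ak)) //= eqxx big1 ?addr0 // => b.
by rewrite -val_eqE /= => /negPf ->; rewrite scaler0.
Qed.

Lemma iter_dirac_linear a : linear (iter a (dirac j)).
Proof. by elim: a => [|a IHa] b p r //=; rewrite IHa dirac_linear. Qed.

Lemma CK_ext_linear : linear CK_ext.
Proof.
move=> b p r; rewrite /CK_ext scaler_sumr -big_split; apply: eq_bigr => a _ /=.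
by rewrite iter_dirac_linear mulrDr scalerDr -scalerAr !scalerA mulrC.
Qed.

Lemma homog_in_CK_ext p : p \in homog_in j k -> CK_ext p \in homog_in j.+1 k.
Proof.
move=> pj; apply: homog_in_slices => a ka; rewrite slice_CK_ext //.
  have [P0 PL] := @homog_in_submod K n j (k - a).
  by rewrite -[_ *: _]addr0; apply: PL => //; apply: homog_in_iter_dirac.
by rewrite (iter_dirac_gt pj) // scaler0.
Qed.

(** Compare coefficients of [x_j^a] through [slice_dirac]. The indices [a >= k] impose nothing:
    slice [a] is then constant, hence killed by [dirac j], and slice [a.+1] is zero. *)
Lemma dirac_eq0P r : r \in homog_in j.+1 k ->
  reflect (forall a, (a < k)%N ->
      (w j a.+1 * (\prod_(l < n | (l < j)%N) u l) * s ^+ (k - a.+1))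
        *: slice j a.+1 r = - ((-1) ^+ a * v j * t ^+ a) *: dirac j (slice j a r))
    (dirac j.+1 r == 0).
Proof.
move=> rj; apply: (iffP eqP) => [r0 a ak|H].
  have := slice_dirac a rj; rewrite r0 linear0 => /esym/eqP.
  by rewrite addrC addr_eq0 => /eqP ->; rewrite scaleNr.
apply: (@slice_inj _ _ j) => a; rewrite linear0 (slice_dirac _ rj).
have [ak|ka] := ltnP a k; first by rewrite H // scaleNr subrr.
rewrite (slice_gt_eq0 (a := a.+1) rj) ?ltnS // scaler0 addr0 (@dirac_homog0 j) ?scaler0 //.
by have := homog_in_slice a rj; rewrite (eqP ka : (k - a)%N = 0%N).
Qed.

Lemma CK_ext_iso :
  linear_iso_between (homog_in j k)
    [pred p | (dirac j.+1 p == 0) && (p \in homog_in j.+1 k)] CK_ext.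
Proof.
split=> [p r _ _ b|p pj|p r pj rj pr|r].
- exact: CK_ext_linear.
- rewrite inE homog_in_CK_ext // andbT; apply/dirac_eq0P => [|a ak].
    exact: homog_in_CK_ext.
  by rewrite !slice_CK_ext // diracZ !scalerA eS // mulNr.
(* Injectivity: since [e 0 = 1], slice 0 of the image gives [p] back. *)
- by have := slice_CK_ext 0 pj; rewrite pr slice_CK_ext //= e0 !scale1r.
rewrite inE => /andP[r0 rj]; have /dirac_eq0P := r0 => /(_ rj) H.
have r0j := homog_in_slice 0 rj; rewrite subn0 in r0j.
(* Surjectivity: the preimage is the restriction of [r] to [x_j = 0]; by induction both sides have
   the same slices. *)
exists (slice j 0 r) => //; apply: (@slice_inj _ _ j) => a; rewrite slice_CK_ext //.
elim: a => [|a IHa]; first by rewrite e0 scale1r.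
have [ak|ka] := ltnP a k; last first.
  by rewrite (slice_gt_eq0 (a := a.+1) rj) // (iter_dirac_gt (a := a.+1) r0j) ?scaler0.
(* The factor of the next slice is nonzero, so the recurrence determines that slice. *)
have B0 : w j a.+1 * (\prod_(l < n | (l < j)%N) u l) * s ^+ (k - a.+1) != 0.
  rewrite !mulf_neq0 // ?expf_neq0 //.
  by apply/prodf_neq0 => l _; apply: u0.
by apply: (scalerI B0); rewrite H // -IHa diracZ !scalerA eS // mulNr.
Qed.

End Dirac.

(** * Specialization to the q-Dirac operator *)

Section QDirac.
Variables (R : realType) (n : nat) (q logq : R[i]) (mu : 'I_n -> R).
Implicit Types (p : {mpoly R[i][n]}) (m : 'X_{1..n}) (i j : 'I_n) (k a : nat).

Lemma mcoeff_qdirac k p m :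
  (qdirac q logq mu k p)@_m = \sum_(i < n | (i < k)%N)
    qnum_mu q logq (mu i) (m i).+1
    * twist_coef (fun l => qpow logq (- (gam mu l / 2)))
        (fun l => qpow logq (gam mu l / 2)) (qpow logq (- 2^-1)) (qpow logq 2^-1)
        k i (m + U_(i))
    * p@_(m + U_(i)).
Proof.
rewrite /qdirac raddf_sum; apply: eq_bigr => i _ /=.
apply: etrans (mcoeff_dunkl (fun i => qpow logq (mu i) / (q - q^-1))
  (fun i => qpow logq (- mu i) / (q - q^-1)) (qpow logq 1) (qpow logq (-1)) _ _ _) _.
rewrite -mulrA; congr (_ * _); last exact: mcoeff_twist.
(* With [e = (-1)^m], the numerator [q^mu (q^m - e) - q^-mu (q^-m - e)] regroups into that of
   [[mu+m]_q - e [mu]_q]; here [m] is the raised exponent. *)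
rewrite /dunkl_coef /qnum_mu /qnum.
rewrite -[qpow logq 1 ^+ _]qpowMn -[qpow logq (-1) ^+ _]qpowMn mul1r mulN1r.
by rewrite opprD !qpowD; set e := (-1) ^+ _; ring.
Qed.

(** From [a] to [a.+1] the sign [(-1)^(a(a+1)/2)] thus changes by [(-1)^(a+1)]. *)
Lemma half_mulSS a : ((a.+1 * a.+2)./2 = (a * a.+1)./2 + a.+1)%N.
Proof.
have -> : (a.+1 * a.+2 = a * a.+1 + a.+1.*2)%N by rewrite -muln2 [(a * _)%N]mulnC -mulnDr addn2.
by rewrite halfD odd_double andbF add0n doubleK.
Qed.

End QDirac.

Theorem proposition7 (R : realType) (n : nat) (q logq : R[i])
    (q_neq0 : q != 0) (normq_neq1 : `|q| != 1) (logqP : expC logq = q)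
    (mu : 'I_n -> R) (mu_gt0 : forall i, 0 < mu i)
    (j : 'I_n) (j_gt0 : (0 < j)%N) (k : nat) :
  linear_iso_between (homog_in j k) (qmonogenic q logq mu j.+1 k)
    (CK q logq mu j k).
Proof.
have w0 a : qnum_mu q logq (mu j) a.+1 != 0 by apply: qnum_mu_neq0.
apply: (CK_ext_iso (w := fun i => qnum_mu q logq (mu i)) (mcoeff_qdirac q logq mu)
  (k := k) (j := j)
  (e := fun a => (-1) ^+ ((a * a.+1)./2)
     * qpow logq (a%:R / 2 * (gam_sum mu j.+1 + k%:R - 1))
     / \prod_(1 <= m < a.+1) qnum_mu q logq (mu j) m)).
- by move=> l; apply: qpow_neq0.
- exact: qpow_neq0.
- exact: w0.
- by rewrite big_geq // !mul0r qpow0 expr0 mulr1 invr1 mulr1.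
(* What remains is the recurrence for the explicit coefficients. *)
move=> a ak; rewrite half_mulSS big_nat_recr //.
have gamS : gam_sum mu j.+1 = gam mu j + gam_sum mu j.
  rewrite /gam_sum (bigD1 j) //=; congr (_ + _); apply: eq_bigl => l.
  by rewrite ltnS -val_eqE andbC -ltn_neqAle.
set G := gam_sum mu j.+1 + k%:R - 1.
(* Balance of exponents, which dictates the step [G / 2] in the powers of [q]: the terms
   [gam_sum mu j / 2] cancel, and so does [k - 1], leaving [gam mu j / 2 + a / 2]. *)
have qG : \prod_(l < n | (l < j)%N) qpow logq (- (gam mu l / 2))
    * qpow logq (- 2^-1) ^+ (k - a.+1) * qpow logq (G / 2)
  = qpow logq (gam mu j / 2) * qpow logq 2^-1 ^+ a.
  rewrite -qpow_sum sumrN -mulr_suml -/(gam_sum mu j) -!qpowMn -!qpowD.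
  by rewrite natrB // -natr1 /G gamS; congr qpow; field.
have -> : a.+1%:R / 2 * G = a%:R / 2 * G + G / 2 by rewrite -natr1; field.
rewrite qpowD exprD exprS.
have P0 : \prod_(1 <= m < a.+1) qnum_mu q logq (mu j) m != 0.
  rewrite big_add1 /= big_mkord; apply/prodf_neq0 => m _; exact: w0.
rewrite -[_ * _ * qpow logq 2^-1 ^+ a]mulrA -qG /=.
have W0 := w0 a; move: P0 W0; clear.
(* With all powers and products made opaque, a rational identity is left whose only denominators are
   [P] and [W]. *)
move: (\prod_(1 <= m < a.+1) _) (qnum_mu _ _ _ _) (\prod_(l < n | _) _) => P W U P0 W0.
move: (qpow _ (G / 2)) (qpow _ (_ * G)) (_ ^+ (k - _)) ((-1) ^+ a) ((-1) ^+ _./2).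
by move=> g h s' x y; field; rewrite P0.
Qed.
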